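(* Let $n\in\mathbb N$ and for $k\in\mathbb N$ let $R_k=\{p\in\beta S_0:\ \forall B\in p\ \exists w\in S_k \text{ with } \{w(\vec x):\vec x\in\mathbb A^k\}\subseteq B\}$. Then $R_{n+1}\subseteq R_n$.
   Context: $\mathbb A$ is a fixed nonempty finite alphabet, $S_0=\mathbb A^+$ the free semigroup of nonempty words over $\mathbb A$, $v_1,v_2,\dots$ distinct variables not in $\mathbb A$, and $S_k$ the set of nonempty words over $\mathbb A\cup\{v_1,\dots,v_k\}$ in which every $v_i$ ($i\le k$) occurs. For $\vec x=(x_1,\dots,x_k)\in\mathbb A^k$, $w(\vec x)$ replaces each occurrence of $v_i$ in $w$ by $x_i$. $\beta S_0$ is the set of ultrafilters on $S_0$ (the Stone–Čech compactification). *)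

(* Defs.v *)
From mathcomp Require Import all_boot.
From mathcomp Require Import boolp classical_sets functions filter.

Set Implicit Arguments.
Unset Strict Implicit.
Unset Printing Implicit Defensive.

Local Open Scope classical_set_scope.

(* A^+, the carrier of the free semigroup on A. *)
Definition S0 (A : finType) := {s : seq A | s != [::]}.

(* Letters are [inl a] with a in the alphabet, or [inr i], which stands for the
   variable v_(i+1); the disjoint sum keeps variables out of the alphabet. *)
Definition Sv (A : finType) (k : nat) :=
  {w : seq (A + 'I_k) | (w != [::]) && [forall i : 'I_k, inr i \in w]}.

Definition subst_letter (A : finType) (k : nat) (x : k.-tuple A)
    (c : A + 'I_k) : A :=
  match c with inl a => a | inr i => tnth x i end.

Lemma subst_neq0 (A : finType) (k : nat) (w : Sv A k) (x : k.-tuple A) :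
  [seq subst_letter x c | c <- val w] != [::].
Proof. by case: w => -[|c w]. Qed.

Definition vsubst (A : finType) (k : nat) (w : Sv A k) (x : k.-tuple A) : S0 A :=
  Sub [seq subst_letter x c | c <- val w] (subst_neq0 w x).

(* Points of the Stone-Cech compactification of the discrete space S0 A. *)
Definition betaS0 (A : finType) : set (set_system (S0 A)) :=
  [set p | UltraFilter p].

Definition Rv (A : finType) (k : nat) : set (set_system (S0 A)) :=
  [set p | betaS0 p /\
    forall B : set (S0 A), p B -> exists w : Sv A k, range (vsubst w) `<=` B].

Arguments Rv A k : clear implicits.

(* Main.v *)
(* Substituting a fixed letter for one variable of a word in S_(n+1), and
   renumbering the others, gives a word in S_n whose instances are among those
   of the original word. *)
Require Import Defs.
From mathcomp Require Import all_boot.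
From mathcomp Require Import boolp classical_sets functions filter.

Local Open Scope classical_set_scope.

(** Given [B] in [p], pick [w] in S_(n+1) with all instances in [B] and put a letter [a] for v_1. By
    [subst_fix_first], the new word at [x] equals [w] at [a :: x], so its instances stay in [B];
    [map_fix_first_Sv] puts it in S_n. *)

Definition fix_first (A : finType) (n : nat) (a : A) (c : A + 'I_n.+1) :
    A + 'I_n :=
  match c with
  | inl b => inl b
  | inr i => if unlift ord0 i is Some j then inr j else inl a
  end.

Lemma subst_fix_first (A : finType) (n : nat) (a : A) (x : n.-tuple A)
    (c : A + 'I_n.+1) :
  subst_letter x (fix_first A n a c) = subst_letter [tuple of a :: x] c.
Proof.
case: c => [//|i] /=; case: unliftP => [j|] -> /=; first by rewrite tnthS.
by rewrite tnth0.
Qed.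

Lemma map_fix_first_Sv (A : finType) (n : nat) (a : A) (w : Sv A n.+1) :
  let s := [seq fix_first A n a c | c <- val w] in
  (s != [::]) && [forall i : 'I_n, inr i \in s].
Proof.
case: w => s /= /andP[s0 /forallP sP]; apply/andP; split; first by case: s s0 {sP}.
(* Each remaining variable comes from its successor, which occurs in the original word. *)
apply/forallP => i; apply/mapP; exists (inr (lift ord0 i)); first exact: sP.
by rewrite /= liftK.
Qed.

Definition fix_first_Sv (A : finType) (n : nat) (a : A) (w : Sv A n.+1) :
    Sv A n :=
  exist (fun s : seq (A + 'I_n) => (s != [::]) && [forall i, inr i \in s])
    [seq fix_first A n a c | c <- val w] (map_fix_first_Sv A n a w).

Theorem theorem5p5 (A : finType) (hA : (0 < #|A|)%N) (n : nat) :
  Rv A n.+1 `<=` Rv A n.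
Proof.
(* Nonemptiness of the alphabet supplies the letter for v_1. *)
have [a _] := card_gt0P hA.
move=> p [pU pR]; split=> // B /pR[w wB].
exists (fix_first_Sv A n a w) => _ [x _ <-].
apply: wB; exists [tuple of a :: x] => //; apply: val_inj => /=.
by rewrite -map_comp; apply: eq_map => c /=; rewrite subst_fix_first.
Qed.
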